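(* Let $1\le p<\infty$ and let $\boldsymbol{w(k)}=(w_n(k))_{n\in\mathbb{N}}$, $k\in\mathbb{N}$, be countably many weights such that each weighted backward shift $B_{\boldsymbol{w(k)}}$ is a continuous operator on the complex Banach space $\ell_p$. Assume that $\inf_{k\in\mathbb{N}}|W_n(k)|>0$ for every $n\in\mathbb{N}$, and that for every $k\in\mathbb{N}$ there exist $C_k>0$, $\tau_k>0$ with $|W_n(k)|^{-p}\le C_kn^{-1}[\log(n+1)]^{-(1+\frac p2+\tau_k)}$ for all $n\ge1$. Suppose there exist integers $2\le\gamma<m$ and an increasing sequence $(\alpha_l)$ of positive real numbers with $\alpha_l\to\infty$ and, for some $\tilde\varepsilon>0$, $\sum_{i=0}^l\alpha_i=\mathcal{O}\big(l^2/(\log l)^{1+\tilde\varepsilon}\big)$, such that for every $k\ge1$ \[ \sum_{n\ge1}\sup\big\{R_n(k,l):\ l\in[m^n,\gamma m^n]\cap\mathbb{N}\big\}<\infty, \] where \[ R_n(k,l)=\sum_{j=\lfloor\alpha_l\rfloor+1}^{m^{n+1}-l-1}\frac{1}{|W_j(k)|^p}+\sum_{j\ge m^{n+1}}\left|\frac{W_j(k)}{W_{j-l}(k)\,\inf_i|W_j(i)|}\right|^p . \] Then there exists a random vector with values in $\ell_p$ that is almost surely a common frequently hypercyclic vector for the family $(B_{\boldsymbol{w(k)}})_{k\in\mathbb{N}}$.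
   Context: $\ell_p$ is the space of complex sequences $(x_n)_{n\ge0}$ with finite $\|x\|_p$, unit vectors $(e_n)_{n\ge0}$. A weight is a bounded sequence of nonzero complex numbers; $B_{\boldsymbol w}e_0=0$, $B_{\boldsymbol w}e_n=w_ne_{n-1}$. $W_n(k)=w_1(k)\cdots w_n(k)$, $W_0(k)=1$. A vector $x$ is frequently hypercyclic for $T$ if for every nonempty open $U$, $\{n: T^nx\in U\}$ has positive lower density ($\liminf_n\#(\cdot\cap[1,n])/n>0$); a common frequently hypercyclic vector is frequently hypercyclic for every member of the family. *)

(* Defs.v *)
From HB Require Import structures.
From mathcomp Require Import all_boot all_order all_algebra.
From mathcomp Require Import all_classical all_reals all_analysis.
From mathcomp Require Import complex.
Set Implicit Arguments. Unset Strict Implicit. Unset Printing Implicit Defensive.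
Import Order.TTheory GRing.Theory Num.Theory numFieldNormedType.Exports.
Local Open Scope ring_scope.
Local Open Scope classical_set_scope.

Section Defs.
Variable R : realType.
Local Notation C := R[i].

Definition cabs (z : C) : R := Normc.normc z.

Definition in_lp (p : R) (x : nat -> C) : Prop :=
  cvgn (series (fun n => cabs (x n) `^ p)).

Definition lpnorm (p : R) (x : nat -> C) : R :=
  (limn (series (fun n => cabs (x n) `^ p))) `^ (p^-1).

Definition lp_open (p : R) (U : set (nat -> C)) : Prop :=
  U `<=` in_lp p /\
  forall x, U x -> exists2 e : R, 0 < e &
    forall y, in_lp p y -> lpnorm p (fun n => y n - x n) < e -> U y.

Definition is_weight (w : nat -> C) : Prop :=
  (forall n, (1 <= n)%N -> w n != 0) /\ exists M : R, forall n, cabs (w n) <= M.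

(* weighted backward shift: B_w e_0 = 0, B_w e_n = w_n e_{n-1} *)
Definition Bw (w : nat -> C) (x : nat -> C) : nat -> C :=
  fun n => w n.+1 * x n.+1.

Definition Wprod (w : nat -> C) (n : nat) : C := \prod_(1 <= i < n.+1) w i.

Definition pos_lower_density (A : set nat) : Prop :=
  (0 < limn_einf (fun N : nat =>
     ((\sum_(1 <= n < N.+1) (`[< A n >] : nat))%:R / N%:R : R)%:E))%E.

Definition freq_hypercyclic (p : R) (T : (nat -> C) -> (nat -> C))
  (x : nat -> C) : Prop :=
  forall U, lp_open p U -> U !=set0 ->
    pos_lower_density [set n | U (iter n T x)].

Definition common_fhc (p : R) (w : nat -> nat -> C) (x : nat -> C) : Prop :=
  forall k, freq_hypercyclic p (Bw (w k)) x.

Definition infW (w : nat -> nat -> C) (j : nat) : R :=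
  inf (range (fun i => cabs (Wprod (w i) j))).

Definition Rnkl (p : R) (w : nat -> nat -> C) (alpha : nat -> R) (m : nat)
  (n k l : nat) : \bar R :=
  ((\sum_(Num.truncn (alpha l) + 1 <= j < m ^ n.+1 - l)
      (cabs (Wprod (w k) j) `^ p)^-1)%:E
   + \sum_(m ^ n.+1 <= j <oo)
      ((cabs (Wprod (w k) j) / (cabs (Wprod (w k) (j - l)) * infW w j)) `^ p)%:E)%E.

Definition supR (p : R) (w : nat -> nat -> C) (alpha : nat -> R) (m gamma : nat)
  (n k : nat) : \bar R :=
  ereal_sup [set Rnkl p w alpha m n k l | l in [set l : nat | (m ^ n <= l <= gamma * m ^ n)%N]].

End Defs.

(* Main.v *)
Require Import Defs.
From HB Require Import structures.
From mathcomp Require Import all_boot all_order all_algebra.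
From mathcomp Require Import all_classical all_reals all_analysis.
From mathcomp Require Import complex.
From mathcomp Require Import zify ring lra.
Set Implicit Arguments.
Unset Strict Implicit.
Unset Printing Implicit Defensive.
Import Order.TTheory GRing.Theory Num.Theory numFieldNormedType.Exports.
Local Open Scope ring_scope.
Local Open Scope classical_set_scope.

(** The random vector is a constant: a deterministic common frequently
    hypercyclic vector [x] is built block by block.  Enumerate by [s] all
    triples (operator [k s], precision [eps s], finitely supported rational
    target [y s]), and give the block [m^n, m^(n+1)) the label
    [s = v_2(n + 1)], so that each label recurs with bounded gaps.  On a block
    labelled [s], [x_j = y_i W_i(k s) / W_j(k s)] with [i = j mod d s], so that
    for every multiple [l] of [d s] in [m^n, gamma m^n] the vector
    [B_{w(k s)}^l x] starts with [y s].  The rest of the same block costs a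
    tail of [sum_j |W_j(k s)|^-p], made small by the choice of [d s]; the later
    blocks cost the second sum of [R_n(k s, l)] weighted by the sizes [c s'] of
    the patterns used there.  The tails of these sums are small uniformly in
    [n] and [l], so starting the pattern [s'] only at a late time [t s']
    compensates its size. *)

(** * Series of nonnegative extended reals and their tails *)

Lemma nneseries_le_bound (R : realType) (f : nat -> \bar R) (B : \bar R) :
  (forall i, 0 <= f i)%E ->
  (forall n, \sum_(0 <= i < n) f i <= B)%E -> (\sum_(0 <= i <oo) f i <= B)%E.
Proof.
move=> f0 fB; apply: lime_le; first by apply: is_cvg_nneseries.
by apply: nearW.
Qed.

Lemma nneseries_ge_term (R : realType) (f : nat -> \bar R) (n : nat) :
  (forall i, 0 <= f i)%E -> (f n <= \sum_(0 <= i <oo) f i)%E.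
Proof.
move=> f0; rewrite (nneseriesD1 (n := n))//.
by rewrite leeDl//; apply: nneseries_ge0.
Qed.

(** After exchanging the two sums, the term [F (f j) j] is a single term of the inner sum over [s].
    With [f := block_label m] this replaces a label depending on the position by a sum over all
    labels. *)
Lemma nneseries_select (R : realType) (F : nat -> nat -> \bar R)
    (f : nat -> nat) : (forall s j, 0 <= F s j)%E ->
  (\sum_(0 <= j <oo) F (f j) j <= \sum_(0 <= s <oo) \sum_(0 <= j <oo) F s j)%E.
Proof.
move=> F0; rewrite nneseries_interchange//; apply: lee_nneseries => // j _.
exact: (@nneseries_ge_term _ (F^~ j)).
Qed.

Lemma eseries_tailE (R : realType) (f : nat -> \bar R) (n : nat) :
  (\sum_(n <= j <oo) f j = \sum_(0 <= j <oo) if (n <= j)%N then f j else 0)%E.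
Proof. by rewrite eseries_cond eseries_mkcond; apply: eq_eseriesr. Qed.

Lemma nneseries_tail_le (R : realType) (f : nat -> \bar R) (n n' : nat) :
  (forall i, 0 <= f i)%E -> (n' <= n)%N ->
  (\sum_(n <= j <oo) f j <= \sum_(n' <= j <oo) f j)%E.
Proof.
move=> f0 n'n; rewrite (eseries_tailE f n) (eseries_tailE f n').
apply: lee_nneseries => j // _; first by case: ifP.
by case: ifP => [/(leq_trans n'n) ->//|_]; case: ifP.
Qed.

Lemma nneseries_tail_small (R : realType) (f : nat -> \bar R) (e : R) :
  (forall i, 0 <= f i)%E -> (\sum_(0 <= i <oo) f i < +oo)%E -> 0 < e ->
  exists N, forall n, (N <= n)%N -> (\sum_(n <= i <oo) f i <= e%:E)%E.
Proof.
move=> f0 foo e0.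
have /= := @nneseries_tail_cvg R f xpredT foo (fun k _ => f0 k).
move=> /fine_cvgP[[N1 _ H1]] /cvgrPdist_le /(_ e e0)[N2 _ H2].
exists (maxn N1 N2) => n; rewrite geq_max => /andP[n1 n2].
have := H1 n n1; have := H2 n n2; rewrite /= sub0r normrN => le_e fin.
by rewrite -(fineK fin) lee_fin (le_trans (ler_norm _)).
Qed.

(** * Membership and norm in ell_p through extended series of p-th powers *)

(** [lpnorm] is built on a real [limn], meaningful only once convergence is known. Estimates are
    therefore made on extended series, which always have a sum, and are brought back to the norm
    here. *)
Lemma lp_of_eseries_lt (R : realType) (p e : R) (z : nat -> R[i]) :
  0 < p -> 0 < e ->
  (\sum_(0 <= i <oo) (cabs (z i) `^ p)%:E < (e `^ p)%:E)%E ->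
  in_lp p z /\ lpnorm p z < e.
Proof.
move=> p0 e0.
set u := fun i => cabs (z i) `^ p.
have u0 i : 0 <= u i by apply: powR_ge0.
set S := (X in (X < _)%E) => Slt.
have S0 : (0 <= S)%E.
  by apply: nneseries_ge0 => i _ _; rewrite lee_fin; exact: u0.
have Sfin : S \is a fin_num by rewrite ge0_fin_numE// (lt_trans Slt)// ltry.
have uS n : series u n <= fine S.
  rewrite -lee_fin fineK// /series/= -sumEFin.
  apply: (@nneseries_lim_ge _ (fun i => (u i)%:E) xpredT 0%N n).
  by move=> i _ _; rewrite lee_fin.
have cu : cvgn (series u).
  apply: nondecreasing_is_cvgn; first by apply: nondecreasing_series => i _.
  by exists (fine S) => _ [n _ <-].
split=> //; rewrite /lpnorm.
have lim0 : 0 <= limn (series u).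
  by apply: limr_ge => //; apply: nearW => n; apply: sumr_ge0.
have limS : limn (series u) <= fine S.
  by apply: limr_le => //; apply: nearW.
have limlt : limn (series u) < e `^ p.
  by rewrite (le_lt_trans limS)// -lte_fin fineK.
have -> : e = (e `^ p) `^ p^-1.
  by rewrite -powRrM divff ?gt_eqF// powRr1// ltW.
by apply: gt0_ltr_powR; rewrite ?invr_gt0// nnegrE// powR_ge0.
Qed.

Lemma eseries_lt_of_in_lp (R : realType) (p : R) (z : nat -> R[i]) :
  in_lp p z -> (\sum_(0 <= i <oo) (cabs (z i) `^ p)%:E < +oo)%E.
Proof.
rewrite /in_lp => cz; set u := fun i => cabs (z i) `^ p.
have u0 i : 0 <= u i by apply: powR_ge0.
apply: (@le_lt_trans _ _ (limn (series u))%:E); last exact: ltry.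
apply: nneseries_le_bound => [i|n]; first by rewrite lee_fin powR_ge0.
rewrite sumEFin lee_fin; apply: (nondecreasing_cvgn_le _ cz).
by apply: nondecreasing_series => i *; exact: u0.
Qed.

Lemma in_lp_of_eseries (R : realType) (p : R) (z : nat -> R[i]) : 0 < p ->
  (\sum_(0 <= i <oo) (cabs (z i) `^ p)%:E < +oo)%E -> in_lp p z.
Proof.
move=> p0; set S := (X in (X < _)%E) => Slt.
have S0 : (0 <= S)%E.
  by apply: nneseries_ge0 => i _ _; rewrite lee_fin powR_ge0.
have Sfin : S \is a fin_num by rewrite ge0_fin_numE.
have F0 : 0 <= fine S by apply: fine_ge0.
apply: (proj1 (@lp_of_eseries_lt _ _ ((fine S + 1) `^ p^-1) _ _ _ _)) => //.
  by apply: powR_gt0; lra.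
rewrite -powRrM mulVf ?gt_eqF// powRr1 -/S ?addr_ge0//.
by rewrite -(fineK Sfin) lte_fin; lra.
Qed.

(** Takes the place of Minkowski's inequality: it applies term by term to sums of p-th powers, at
    the cost of a factor [2 ^ p] that is absorbed when the precision is chosen. *)
Lemma powRD_le (R : realType) (p a b : R) : 0 <= p -> 0 <= a -> 0 <= b ->
  (a + b) `^ p <= 2 `^ p * (a `^ p + b `^ p).
Proof.
move=> p0; wlog ab : a b / a <= b => [H a0 b0|a0 b0].
  by have [ab|/ltW ba] := leP a b; [|rewrite addrC [X in 2 `^ p * X]addrC];
    exact: H.
apply: (@le_trans _ _ ((2 * b) `^ p)).
  by apply: ge0_ler_powR => //; rewrite ?nnegrE; lra.
by rewrite powRM ?ler_wpM2l ?powR_ge0 ?lerDr ?powR_ge0.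
Qed.

(** * Summability under logarithmic decay *)

(** Discrete form of the integral test: the right-hand side telescopes in [n]. It combines 1/n <= 2
    (v - u) with the convexity of x^(-a), where u = ln n and v = ln (n + 1). *)
Lemma inv_mul_ln_powR_le (R : realType) (a : R) (n : nat) : 0 < a ->
  (2 <= n)%N ->
  n%:R^-1 * ln n.+1%:R `^ (- (1 + a)) <=
    2 / a * (ln n%:R `^ (- a) - ln n.+1%:R `^ (- a)) :> R.
Proof.
move=> a0 n2.
have nR : 2 <= n%:R :> R by rewrite ler_nat.
set u : R := ln n%:R; set v : R := ln n.+1%:R.
have n1E : n.+1%:R = n%:R + 1 :> R by rewrite -natr1.
have u0 : 0 < u by apply: ln_gt0; lra.
have v0 : 0 < v by apply: ln_gt0; rewrite n1E; lra.
have lnE : ln (n%:R / (n%:R + 1)) = u - v :> R.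
  by rewrite ln_div ?posrE -?n1E ?ltr0n//; lia.
have vu : n%:R^-1 <= 2 * (v - u).
  have : ln (n%:R / (n%:R + 1)) <= n%:R / (n%:R + 1) - 1 :> R.
    have := @le_ln1Dx R (n%:R / (n%:R + 1) - 1).
    rewrite addrCA subrr addr0; apply.
    by rewrite ltrBrDr addNr divr_gt0//; lra.
  rewrite lnE => H.
  have h1 : (n%:R + 1)^-1 = 1 - n%:R / (n%:R + 1) :> R by field; lra.
  have h2 : n%:R^-1 <= 2 * (n%:R + 1)^-1 :> R.
    have -> : 2 * (n%:R + 1)^-1 = ((n%:R + 1) / 2)^-1 :> R by field; lra.
    by rewrite lef_pV2 ?posrE; lra.
  lra.
have tp : 0 < u / v by apply: divr_gt0.
have lnt : ln (u / v) <= u / v - 1.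
  have := @le_ln1Dx R (u / v - 1).
  by rewrite addrCA subrr addr0; apply; lra.
(* Tangent bound at v. After division by v^(-a) it follows from (u/v)^(-a) = exp(-a ln(u/v)) >= 1 -
   a ln(u/v) and ln(u/v) <= u/v - 1. *)
have conv : a * (v - u) * v `^ (- (1 + a)) <= u `^ (- a) - v `^ (- a).
  have -> : u = u / v * v by field; lra.
  rewrite powRM; [|lra|lra].
  have -> : v `^ (- (1 + a)) = v^-1 * v `^ (- a).
    by rewrite opprD powRD ?powR_inv1 //; [lra|apply/implyP => _; lra].
  have vp : 0 < v `^ (- a) by apply: powR_gt0.
  have -> : a * (v - u / v * v) * (v^-1 * v `^ (- a)) =
     (a * (1 - u / v)) * v `^ (- a) by field; lra.
  rewrite -[X in _ <= _ - X]mul1r -mulrBl ler_pM2r//.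
  have -> : (u / v) `^ (- a) = expR (- a * ln (u / v)).
    by rewrite /powR gt_eqF.
  have := @expR_ge1Dx R (- a * ln (u / v)).
  have : a * ln (u / v) <= a * (u / v - 1) by rewrite ler_pM2l.
  lra.
apply: (@le_trans _ _ (2 * (v - u) * v `^ (- (1 + a)))).
  by rewrite ler_wpM2r ?powR_ge0.
have -> : 2 * (v - u) * v `^ (- (1 + a)) =
  2 / a * (a * (v - u) * v `^ (- (1 + a))) by field; lra.
by rewrite ler_wpM2l// divr_ge0//; lra.
Qed.

Lemma nneseries_log_decay (R : realType) (f : nat -> R) (C a : R) :
  (forall n, 0 <= f n) -> 0 < C -> 0 < a ->
  (forall n, (1 <= n)%N ->
     f n <= C * n%:R^-1 * ln n.+1%:R `^ (- (1 + a))) ->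
  (\sum_(0 <= n <oo) (f n)%:E < +oo)%E.
Proof.
move=> f0 C0 a0 fC.
have f0' i : (0 <= (f i)%:E)%E by rewrite lee_fin.
(* The telescoping starts at n = 2, where ln n > 0; the two terms before it are merely finite. *)
rewrite (@nneseries_split R _ 0 2)//.
rewrite sumEFin ltey_eq; apply/orP; left; rewrite fin_numD/=.
rewrite ge0_fin_numE; last by apply: nneseries_ge0.
apply: (@le_lt_trans _ _ (C * (2 / a * ln 2 `^ (- a)))%:E); last exact: ltry.
rewrite -(nneseries_addn)//.
apply: nneseries_le_bound => // N.
rewrite sumEFin lee_fin.
apply: (@le_trans _ _ (C * (2 / a * (ln 2 `^ (- a) - ln (N.+2)%:R `^ (- a))))).
  elim: N => [|N IH]; first by rewrite big_nil subrr !mulr0.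
  rewrite big_nat_recr//=.
  have := @inv_mul_ln_powR_le R a N.+2 a0 isT.
  have := fC (N + 2)%N; rewrite addn2 => /(_ isT).
  rewrite -mulrA => H1 H2.
  have : C * (N.+2%:R^-1 * ln N.+3%:R `^ (- (1 + a))) <=
     C * (2 / a * (ln N.+2%:R `^ (- a) - ln N.+3%:R `^ (- a))).
    by rewrite ler_pM2l.
  move: (f N.+2) (ln 2 `^ (- a)) (ln N.+2%:R `^ (- a)) (ln N.+3%:R `^ (- a))
    (2 / a) (\sum_(0 <= i < N) _) (N.+2%:R^-1 * _) IH H1 => *; lra.
rewrite !ler_pM2l ?divr_gt0// lerBlDr lerDl; exact: powR_ge0.
Qed.

(** * Positive lower density of multiples of d taken from the blocks of one label *)

Lemma limn_einf_ge (R : realType) (u : nat -> \bar R) (c : \bar R) (n0 : nat) :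
  (forall n, (n0 <= n)%N -> (c <= u n)%E) -> (c <= limn_einf u)%E.
Proof.
move=> cu; rewrite limn_einf_lim; apply: lime_ge; first exact: is_cvg_einfs.
exists n0 => // n /= n0n; apply: le_ereal_inf_tmp => _ [i /= ni <-].
exact/cu/(leq_trans n0n).
Qed.

(** The numbers of 2-adic valuation [s] are 2^s (2t + 1), spaced by 2^(s+1); the witness is the
    largest of them not exceeding n' + 1, minus 1. *)
Lemma logn2S_near (s n' : nat) : (2 ^ s.+1 <= n')%N ->
  exists n, [/\ (n <= n')%N, (n' < n + 2 ^ s.+1)%N & logn 2 n.+1 = s].
Proof.
move=> sn; set t := ((n'.+1 - 2 ^ s) %/ 2 ^ s.+1)%N.
have p0 : (0 < 2 ^ s)%N by rewrite expn_gt0.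
have E : (2 ^ s.+1 = 2 * 2 ^ s)%N by rewrite expnS.
have nE : ((2 ^ s * (2 * t).+1).-1.+1 = 2 ^ s * (2 * t).+1)%N.
  by rewrite prednK// muln_gt0 p0.
exists (2 ^ s * (2 * t).+1).-1.
have := divn_eq (n'.+1 - 2 ^ s) (2 ^ s.+1); rewrite -/t.
have : ((n'.+1 - 2 ^ s) %% 2 ^ s.+1 < 2 ^ s.+1)%N.
  by rewrite ltn_mod expn_gt0.
move: (_ %% _)%N => r; rewrite E => rlt tE; rewrite nE; split; [nia|nia|].
rewrite lognM// pfactorK// (_ : logn 2 (2 * t).+1 = 0%N) ?addn0//.
by rewrite lognE /= dvdn2 /= oddM /=.
Qed.

(** Up to time T, the last block of label [s] whose start a = m^n satisfies 2a <= T is already of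
    size comparable to T. Since gamma >= 2, the multiples of d in [a, 2a] all lie in A, and there
    are about a/d of them. *)
Lemma pos_lower_density_blocks (R : realType) (m gamma d s n0 : nat)
    (A : set nat) : (2 <= gamma)%N -> (gamma < m)%N -> (0 < d)%N ->
  (forall n l, (n0 <= n)%N -> logn 2 n.+1 = s ->
     (m ^ n <= l <= gamma * m ^ n)%N -> (d %| l)%N -> A l) ->
  pos_lower_density R A.
Proof.
move=> g2 gm d0 hA; rewrite /pos_lower_density.
have m1 : (1 < m)%N by lia.
set P := (2 ^ s.+1)%N.
(* One factor 2 comes from T < 2 a m^P, the other from a <= 2 d (a %/ d). *)
set c : R := (4 * d * m ^ P)%:R^-1.
have K0 : (0 < 4 * d * m ^ P)%N by rewrite !muln_gt0 d0 expn_gt0; lia.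
apply: (@lt_le_trans _ _ c%:E); first by rewrite lte_fin invr_gt0 ltr0n.
apply: (limn_einf_ge (n0 := 2 * m ^ (n0 + d + P))) => T hT; rewrite lee_fin.
have T0 : (0 < T)%N by apply: leq_trans hT; rewrite muln_gt0 expn_gt0; lia.
rewrite ler_pdivlMr ?ltr0n// mulrC ler_pdivrMr ?ltr0n// -natrM ler_nat.
(* Halving T makes the whole window [a, 2a] fit below T. *)
set n' := trunc_log m (T %/ 2).
have hT2 : (m ^ (n0 + d + P) <= T %/ 2)%N by rewrite leq_divRL// mulnC.
have n'ge : (n0 + d + P <= n')%N by apply: trunc_log_max.
have T20 : (0 < T %/ 2)%N by apply: leq_trans hT2; rewrite expn_gt0; lia.
have lo : (m ^ n' <= T %/ 2)%N by apply: trunc_logP.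
have hi : (T %/ 2 < m ^ n'.+1)%N by apply: trunc_log_ltn.
have [n [nn' n'n ns]] : exists n, [/\ (n <= n')%N, (n' < n + P)%N & logn 2 n.+1 = s].
  by apply: logn2S_near; rewrite -/P; lia.
set a := (m ^ n)%N.
have ad : (d <= a)%N.
  by apply: (@leq_trans n); [lia|apply/ltnW/ltn_expl].
have aT : (2 * a <= T)%N.
  have : (a <= m ^ n')%N by rewrite leq_exp2l.
  lia.
have Ta : (T < 2 * (a * m ^ P))%N.
  have : (m ^ n'.+1 <= a * m ^ P)%N by rewrite -expnD leq_exp2l.
  lia.
have cnt : (a %/ d <= \sum_(1 <= i < T.+1) (`[< A i >] : nat))%N.
  have -> : (\sum_(1 <= i < T.+1) (`[< A i >] : nat) =
      size [seq i <- index_iota 1 T.+1 | `[< A i >]])%N.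
    rewrite size_filter -sum1_count [RHS]big_mkcond.
    by apply: eq_bigr => i _; case: `[< _ >].
  (* For j < a %/ d the multiples (a %/ d + j + 1) d are distinct, exceed a and are at most 2a. *)
  rewrite -[X in (X <= _)%N](size_iota 0) -(size_map (fun j => (a %/ d + j.+1) * d)%N).
  apply: uniq_leq_size.
    by rewrite map_inj_uniq ?iota_uniq// => i j /eqP; rewrite eqn_mul2r; lia.
  move=> l /mapP[j]; rewrite mem_iota add0n /= => jlt ->.
  have aE := divn_eq a d; have := ltn_pmod a d0 => rlt.
  rewrite mem_filter mem_index_iota; apply/andP; split; last first.
    by apply/andP; split; nia.
  apply/asboolP; apply: (hA n) => //; [lia| |exact: dvdn_mull].
  by rewrite -/a; apply/andP; split; nia.
apply: (@leq_trans (4 * d * m ^ P * (a %/ d))); last by rewrite mulnC leq_mul2r cnt orbT.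
have aE := divn_eq a d; have := ltn_pmod a d0 => rlt.
have q1 : (0 < a %/ d)%N by rewrite divn_gt0.
have : (a <= 2 * (d * (a %/ d)))%N by nia.
move: (a %/ d)%N (m ^ P)%N Ta => q M Ta aq.
have : (a * M <= 2 * (d * q) * M)%N by rewrite leq_mul2r aq orbT.
nia.
Qed.

(** * Weight products, iterates of the shift, and the modulus *)

Lemma WprodS (R : realType) (v : nat -> R[i]) (n : nat) :
  Wprod v n.+1 = Wprod v n * v n.+1.
Proof. by rewrite /Wprod big_nat_recr. Qed.

Lemma Wprod_neq0 (R : realType) (v : nat -> R[i]) (n : nat) :
  is_weight v -> Wprod v n != 0.
Proof.
case=> v0 _; elim: n => [|n IH]; first by rewrite /Wprod big_nil oner_neq0.
by rewrite WprodS mulf_neq0// v0.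
Qed.

(** The division-free form lets the induction go through without assuming nonzero weights. *)
Lemma iter_BwE (R : realType) (v x : nat -> R[i]) (l i : nat) :
  iter l (Bw v) x i * Wprod v i = Wprod v (i + l) * x (i + l)%N.
Proof.
elim: l i => [|l IH] i; first by rewrite addn0 mulrC.
by rewrite iterS /Bw mulrAC (mulrC (v _)) -WprodS mulrC IH addnS addSn.
Qed.

Lemma cabs_ge0 (R : realType) (z : R[i]) : 0 <= cabs z.
Proof. by case: z => a b; exact: sqrtr_ge0. Qed.

Lemma cabs_gt0 (R : realType) (z : R[i]) : z != 0 -> 0 < cabs z.
Proof.
rewrite lt_neqAle cabs_ge0 andbT eq_sym; apply: contra => /eqP z0.
by rewrite (Normc.eq0_normc (esym z0)).
Qed.

Lemma cabsM (R : realType) (z z' : R[i]) : cabs (z * z') = cabs z * cabs z'.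
Proof. exact: Normc.normcM. Qed.

Lemma cabs0 (R : realType) : cabs (0 : R[i]) = 0.
Proof. exact: Normc.normc0. Qed.

Lemma cabsV (R : realType) (z : R[i]) : cabs z^-1 = (cabs z)^-1.
Proof. exact: Normc.normcV. Qed.

Lemma cabsD_powR_le (R : realType) (p : R) (z z' : R[i]) : 0 <= p ->
  cabs (z + z') `^ p <= 2 `^ p * (cabs z `^ p + cabs z' `^ p).
Proof.
move=> p0; apply: le_trans (powRD_le p0 (cabs_ge0 z) (cabs_ge0 z')).
by apply: ge0_ler_powR; rewrite ?nnegrE ?addr_ge0 ?cabs_ge0//; exact: le_normcD.
Qed.

Lemma rat_complex_approx (R : realType) (z : R[i]) (e : R) : 0 < e ->
  exists q : rat * rat,
    cabs ((ratr q.1 +i* ratr q.2)%C - z) < e.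
Proof.
move=> e0; case: z => a b.
have h (r : R) : exists q : rat, `|ratr q - r| < e / 2.
  have /rat_in_itvoo[q /itvP qr] : r - e / 2 < r + e / 2 by lra.
  by exists q; rewrite ltr_distl !qr.
have [[q1 h1] [q2 h2]] := (h a, h b); exists (q1, q2).
rewrite [X in cabs X](_ : _ =
  ((ratr q1 - a) +i* 0)%C + (0 +i* (ratr q2 - b))%C); last first.
  by apply/eqP; rewrite eq_complex /= ?addr0 ?add0r !eqxx.
apply: le_lt_trans (le_normcD _ _) _.
rewrite /Normc.normc !expr0n /= addr0 add0r !sqrtr_sqr; lra.
Qed.

(** * The block vector and its orbit *)

(** Summand of the second series in [Rnkl]. Because of [infW], it does not depend on the operator
    attached to the block containing j. *)
Definition shift_ratio (R : realType) (p : R) (w : nat -> nat -> R[i])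
    (k l j : nat) : R :=
  (cabs (Wprod (w k) j) / (cabs (Wprod (w k) (j - l)) * infW w j)) `^ p.

Definition block_label (m j : nat) : nat := logn 2 (trunc_log m j).+1.

Definition block_vector (R : realType) (w : nat -> nat -> R[i]) (m : nat)
    (k d t : nat -> nat) (b : nat -> nat -> R[i]) (j : nat) : R[i] :=
  let s := block_label m j in
  if (t s <= j)%N then b s (j %% d s)%N / Wprod (w (k s)) j else 0.

Lemma shift_ratio_ge0 (R : realType) (p : R) (w : nat -> nat -> R[i])
    (k l j : nat) : 0 <= shift_ratio p w k l j.
Proof. exact: powR_ge0. Qed.

Lemma infW_gt0 (R : realType) (w : nat -> nat -> R[i]) (j : nat) :
  (exists2 c : R, 0 < c & forall k, c <= cabs (Wprod (w k) j)) -> 0 < infW w j.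
Proof.
case=> c c0 cW; apply: (lt_le_trans c0); apply: lb_le_inf.
  by exists (cabs (Wprod (w 0%N) j)); exists 0%N.
by move=> _ [k _ <-].
Qed.

Lemma infW_le (R : realType) (w : nat -> nat -> R[i]) (j k : nat) :
  infW w j <= cabs (Wprod (w k) j).
Proof.
apply: ge_inf; last by exists k.
by exists 0 => _ [i _ <-]; exact: cabs_ge0.
Qed.

Lemma cabs_div_Wprod_powR (R : realType) (p : R) (v : nat -> R[i]) (z : R[i])
    (j : nat) :
  cabs (z / Wprod v j) `^ p = cabs z `^ p * cabs (Wprod v j) `^ (- p).
Proof.
rewrite cabsM cabsV powRM ?invr_ge0 ?cabs_ge0// powRN.
by rewrite -(powR_inv1 (cabs_ge0 _)) -powRrM mulN1r powRN.
Qed.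

(** Each label [s] is charged as if it occupied every position from [t s] on; these costs are at
    most 2^-(s+1) and add up to at most 1. *)
Lemma block_vector_summable (R : realType) (p : R) (w : nat -> nat -> R[i])
    (m : nat) (k d t : nat -> nat) (b : nat -> nat -> R[i]) (c : nat -> R) :
  0 < p -> (forall s, 0 <= c s) ->
  (forall s i, cabs (b s i) `^ p <= c s) ->
  (forall s, \sum_(t s <= j <oo) (c s * cabs (Wprod (w (k s)) j) `^ (- p))%:E
     <= (1 / (2 ^ s.+1)%:R)%:E)%E ->
  in_lp p (block_vector w m k d t b).
Proof.
move=> p0 c0 bc ct; apply: in_lp_of_eseries => //.
pose F s j : \bar R :=
  if (t s <= j)%N then (c s * cabs (Wprod (w (k s)) j) `^ (- p))%:E else 0%E.
have F0 s j : (0 <= F s j)%E.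
  by rewrite /F; case: ifP => // _; rewrite lee_fin mulr_ge0 ?powR_ge0.
apply: (@le_lt_trans _ _ (\sum_(0 <= j <oo) F (block_label m j) j)%E).
  apply: lee_nneseries => j *; first by rewrite lee_fin powR_ge0.
  rewrite /block_vector /F; case: ifP => _.
    by rewrite lee_fin cabs_div_Wprod_powR ler_wpM2r ?powR_ge0.
  by rewrite cabs0 powR0 ?gt_eqF.
apply: (le_lt_trans (nneseries_select _ F0)).
apply: (@le_lt_trans _ _ 1%:E); last exact: ltry.
apply: le_trans (epsilon_trick0 xpredT (@ler01 R)).
apply: lee_nneseries => s *; first by apply: nneseries_ge0.
by rewrite -eseries_tailE.
Qed.

(* Inside the block [m^n, m^(n+1)) the orbit repeats [y] with period [d s]; all
   later blocks are dominated by the ratios occurring in [Rnkl]. *)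
Lemma block_vector_orbit (R : realType) (p : R) (w : nat -> nat -> R[i])
    (m gamma : nat) (k d t : nat -> nat) (b : nat -> nat -> R[i])
    (c : nat -> R) (y : nat -> R[i]) (s n l : nat) :
  0 < p -> (forall i, is_weight (w i)) -> (forall j, 0 < infW w j) ->
  (0 < gamma)%N -> (gamma < m)%N -> (forall s, 0 <= c s) ->
  (forall s i, cabs (b s i) `^ p <= c s) ->
  (forall i, b s i = y i * Wprod (w (k s)) i) ->
  (forall i, (d s <= i)%N -> y i = 0) ->
  (0 < d s <= m ^ n)%N -> (t s <= m ^ n)%N -> logn 2 n.+1 = s ->
  (m ^ n <= l <= gamma * m ^ n)%N -> (d s %| l)%N ->
  (\sum_(0 <= i <oo)
      (cabs (iter l (Bw (w (k s))) (block_vector w m k d t b) i - y i) `^ p)%:E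
   <= \sum_(d s <= i <oo) (c s * cabs (Wprod (w (k s)) i) `^ (- p))%:E +
      \sum_(0 <= s' <oo) \sum_(maxn (t s') (m ^ n.+1) <= j <oo)
         (c s' * shift_ratio p w (k s) l j)%:E)%E.
Proof.
move=> p0 hw W0 g0 gm c0 bc bE y0 /andP[d0 dm] tm ns /andP[ml lg] dl.
have m1 : (1 < m)%N by lia.
set x := block_vector w m k d t b.
pose F s' j : \bar R := if (maxn (t s') (m ^ n.+1) <= j)%N
  then (c s' * shift_ratio p w (k s) l j)%:E else 0%E.
have F0 s' j : (0 <= F s' j)%E.
  by rewrite /F; case: ifP => // _; rewrite lee_fin mulr_ge0 ?shift_ratio_ge0.
pose H i : \bar R :=
  if (d s <= i)%N then (c s * cabs (Wprod (w (k s)) i) `^ (- p))%:E else 0%E.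
have H0 i : (0 <= H i)%E.
  by rewrite /H; case: ifP => // _; rewrite lee_fin mulr_ge0 ?powR_ge0.
have iterE i : iter l (Bw (w (k s))) x i =
    Wprod (w (k s)) (i + l) / Wprod (w (k s)) i * x (i + l)%N.
  apply: (mulIf (Wprod_neq0 i (hw (k s)))); rewrite iter_BwE mulrAC.
  by rewrite mulfVK ?Wprod_neq0.
have pt i : ((cabs (iter l (Bw (w (k s))) x i - y i) `^ p)%:E <=
    H i + F (block_label m (i + l)) (i + l)%N)%E.
  have [near_|far] := ltnP (i + l) (m ^ n.+1).
    have lab : block_label m (i + l) = s.
      rewrite /block_label (_ : trunc_log m (i + l) = n)//.
      by apply: trunc_log_eq; rewrite // near_ (leq_trans ml) ?leq_addl.
    apply: (@le_trans _ _ (H i)); last by rewrite leeDl.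
    rewrite iterE /x /block_vector lab (leq_trans tm) ?(leq_trans ml) ?leq_addl//.
    (* As [d s] divides l, the shift preserves the phase of the periodic pattern. *)
    have -> : ((i + l) %% d s = i %% d s)%N.
      by rewrite -modnDmr (eqP dl) addn0.
    rewrite mulrA mulrAC [X in X / _ * _]mulrC -!mulrA mulVKf ?Wprod_neq0//.
    rewrite /H; have [di|di] := leqP (d s) i.
      rewrite y0// subr0 mulrC cabs_div_Wprod_powR lee_fin.
      by rewrite ler_wpM2r ?powR_ge0.
    rewrite modn_small// bE mulrC mulfK ?Wprod_neq0// subrr cabs0.
    by rewrite powR0 ?gt_eqF.
  apply: (@le_trans _ _ (F (block_label m (i + l)) (i + l)%N)); last first.
    by rewrite leeDr.
  (* From gamma + 1 <= m: i >= m^(n+1) - gamma m^n >= m^n >= [d s], so the target vanishes at i. *)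
  have di : (d s <= i)%N.
    have : (m ^ n.+1 = m * m ^ n)%N by rewrite expnS.
    move: (m ^ n)%N dm lg far ml => M; nia.
  rewrite y0// subr0 iterE /x /block_vector /F geq_max far andbT.
  set s' := block_label m (i + l).
  case: ifP => _; last by rewrite mulr0 cabs0 powR0 ?gt_eqF.
  rewrite lee_fin [leLHS](_ : _ = cabs (b s' ((i + l) %% d s')%N) `^ p *
    (cabs (Wprod (w (k s)) (i + l)) / (cabs (Wprod (w (k s)) i) *
      cabs (Wprod (w (k s')) (i + l)))) `^ p); last first.
    rewrite !cabsM !cabsV -powRM ?cabs_ge0//.
      by congr (_ `^ p); rewrite invfM; ring.
    by rewrite divr_ge0 ?mulr_ge0 ?cabs_ge0.
  apply: ler_pM; rewrite ?powR_ge0// /shift_ratio addnK.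
  have Wi := cabs_gt0 (Wprod_neq0 i (hw (k s))).
  apply: ge0_ler_powR; rewrite ?nnegrE ?divr_ge0 ?mulr_ge0 ?cabs_ge0//.
  - exact: ltW.
  - exact: ltW.
  (* The weight product of the foreign label [s'] is replaced by the infimum over all operators. *)
  rewrite ler_wpM2l ?cabs_ge0// lef_pV2 ?posrE ?mulr_gt0//.
    by rewrite ler_pM2l// infW_le.
  exact: lt_le_trans (W0 _) (infW_le _ _ _).
apply: (@le_trans _ _ (\sum_(0 <= i <oo)
    (H i + F (block_label m (i + l)) (i + l)%N))%E).
  by apply: lee_nneseries => i *; [rewrite lee_fin powR_ge0|exact: pt].
rewrite nneseriesD//; apply: leeD; first by rewrite [leRHS]eseries_tailE.
rewrite (@nneseries_addn _ (fun j => F (block_label m j) j))//.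
apply: (@le_trans _ _ (\sum_(0 <= j <oo) F (block_label m j) j)%E).
  exact: nneseries_tail_le.
apply: (le_trans (nneseries_select _ F0)).
apply: lee_nneseries => s' *; first by apply: nneseries_ge0.
by rewrite [leRHS]eseries_tailE.
Qed.

(** * Uniform smallness of the ratio sums *)

Lemma shift_ratio_sum_le_supR (R : realType) (p : R) (w : nat -> nat -> R[i])
    (alpha : nat -> R) (m gamma n k l : nat) :
  (m ^ n <= l <= gamma * m ^ n)%N ->
  (\sum_(m ^ n.+1 <= j <oo) (shift_ratio p w k l j)%:E
     <= supR p w alpha m gamma n k)%E.
Proof.
move=> hl; apply: (@le_trans _ _ (Rnkl p w alpha m n k l)).
  rewrite /Rnkl leeDr// lee_fin; apply: sumr_ge0 => j _.
  by rewrite invr_ge0 powR_ge0.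
by apply: ereal_sup_ubound; exists l.
Qed.

(** gamma > 0 puts l = m^n in the range; a supremum over an empty range would be -oo. *)
Lemma supR_ge0 (R : realType) (p : R) (w : nat -> nat -> R[i])
    (alpha : nat -> R) (m gamma n k : nat) : (0 < gamma)%N ->
  (0 <= supR p w alpha m gamma n k)%E.
Proof.
move=> g0; apply: (le_trans _ (@shift_ratio_sum_le_supR _ _ _ _ _ _ _ _ (m ^ n) _)).
  by apply: nneseries_ge0 => *; rewrite lee_fin shift_ratio_ge0.
by rewrite leqnn leq_pmull.
Qed.

Lemma supR_small (R : realType) (p : R) (w : nat -> nat -> R[i])
    (alpha : nat -> R) (m gamma k : nat) (e : R) : (0 < gamma)%N ->
  (\sum_(1 <= n <oo) supR p w alpha m gamma n k < +oo)%E -> 0 < e ->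
  exists n0, forall n, (n0 <= n)%N -> (supR p w alpha m gamma n k <= e%:E)%E.
Proof.
move=> g0 sR e0.
have S0 n : (0 <= supR p w alpha m gamma n k)%E by exact: supR_ge0.
have sR' : (\sum_(0 <= n <oo) supR p w alpha m gamma n.+1 k < +oo)%E.
  rewrite (eq_eseriesr (g := fun n => supR p w alpha m gamma (n + 1)%N k)).
    by rewrite (@nneseries_addn _ (fun n => supR p w alpha m gamma n k)).
  by move=> n _; rewrite addn1.
have [N hN] := nneseries_tail_small (fun n => S0 n.+1) sR' e0.
exists N.+1 => -[//|n] Nn; apply: le_trans (hN n Nn).
rewrite -(nneseries_addn (f := fun n => supR p w alpha m gamma n.+1 k))//.
exact: (@nneseries_ge_term _ (fun i => supR p w alpha m gamma (i + n).+1 k) 0%N).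
Qed.

Lemma supR_lty (R : realType) (p : R) (w : nat -> nat -> R[i])
    (alpha : nat -> R) (m gamma k n : nat) : (0 < gamma)%N ->
  (\sum_(1 <= n <oo) supR p w alpha m gamma n k < +oo)%E -> (0 < n)%N ->
  (supR p w alpha m gamma n k < +oo)%E.
Proof.
move=> g0 sR n0; apply: le_lt_trans sR; rewrite eseries_tailE.
rewrite [leLHS](_ : _ = if (1 <= n)%N then supR p w alpha m gamma n k else 0%E);
  last by rewrite n0.
apply: (@nneseries_ge_term _
  (fun n => if (1 <= n)%N then supR p w alpha m gamma n k else 0%E)).
by move=> i; case: ifP => // _; exact: supR_ge0.
Qed.

(** For large n the bound is that of [supR], whatever t is. Only finitely many pairs (n, l) remain,
    each giving the tail of a convergent series, and [t0] is the maximum of their thresholds. *)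
Lemma shift_ratio_tail_small (R : realType) (p : R) (w : nat -> nat -> R[i])
    (alpha : nat -> R) (m gamma k : nat) (e : R) : (0 < gamma)%N ->
  (\sum_(1 <= n <oo) supR p w alpha m gamma n k < +oo)%E -> 0 < e ->
  exists t0, forall t n l, (t0 <= t)%N -> (0 < n)%N ->
    (m ^ n <= l <= gamma * m ^ n)%N ->
    (\sum_(maxn t (m ^ n.+1) <= j <oo) (shift_ratio p w k l j)%:E <= e%:E)%E.
Proof.
move=> g0 sR e0; have [n0 hn0] := supR_small g0 sR e0.
have r0 l j : (0 <= (shift_ratio p w k l j)%:E)%E.
  by rewrite lee_fin shift_ratio_ge0.
have /choice[f hf] : forall nl : nat * nat, exists t0, forall t, (t0 <= t)%N ->
    (0 < nl.1)%N -> (m ^ nl.1 <= nl.2 <= gamma * m ^ nl.1)%N ->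
    (\sum_(maxn t (m ^ nl.1.+1) <= j <oo) (shift_ratio p w k nl.2 j)%:E
       <= e%:E)%E.
  case=> n l /=; case hnl : ((0 < n) && (m ^ n <= l <= gamma * m ^ n))%N;
    last by exists 0%N => t _ n1 hl; rewrite n1 hl in hnl.
  have /andP[n1 hl] := hnl.
  have := le_lt_trans (shift_ratio_sum_le_supR p w alpha k hl)
    (supR_lty g0 sR n1).
  rewrite eseries_tailE.
  move=> /(nneseries_tail_small (e := e)) [|//|t0 ht0].
    by move=> i; case: ifP.
  exists t0 => t t0t _ _; apply: le_trans (ht0 t t0t).
  rewrite [leLHS]eseries_tailE [leRHS]eseries_tailE.
  apply: lee_nneseries => j *; first by case: ifP.
  by rewrite geq_max; case: (t <= j)%N.
exists (\max_(n < n0) \max_(l < (gamma * m ^ n).+1) f (n : nat, l : nat)).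
move=> t n l tge n1 hl; have [n0n|nn0] := leqP n0 n.
  apply: le_trans (hn0 n n0n); apply: le_trans (shift_ratio_sum_le_supR _ _ _ _ hl).
  by apply: nneseries_tail_le => //; rewrite leq_maxr.
apply: (hf (n, l)) => //; apply: leq_trans tge.
have lb : (l < (gamma * m ^ n).+1)%N by have /andP[] := hl.
apply: leq_trans (leq_bigmax (Ordinal nn0)) => /=.
exact: (leq_bigmax (F := fun i : 'I__ => f (n, i : nat)) (Ordinal lb)).
Qed.

(** Labels s >= s0 contribute a geometric tail independent of n; for the finitely many others,
    [supR] tends to 0 and beats the total size K of their patterns. The choice s0 >= k is what makes
    the hypothesis on [t] available in the tail. *)
Lemma shift_ratio_double_sum_small (R : realType) (p : R)
    (w : nat -> nat -> R[i]) (alpha : nat -> R) (m gamma k : nat)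
    (c : nat -> R) (t : nat -> nat) (e : R) : (0 < gamma)%N ->
  (\sum_(1 <= n <oo) supR p w alpha m gamma n k < +oo)%E ->
  (forall s, 0 <= c s) ->
  (forall s n l, (k <= s)%N -> (0 < n)%N -> (m ^ n <= l <= gamma * m ^ n)%N ->
    (\sum_(maxn (t s) (m ^ n.+1) <= j <oo) (c s * shift_ratio p w k l j)%:E
       <= (1 / (2 ^ s.+1)%:R)%:E)%E) -> 0 < e ->
  exists n0, forall n l, (n0 <= n)%N -> (m ^ n <= l <= gamma * m ^ n)%N ->
    (\sum_(0 <= s <oo) \sum_(maxn (t s) (m ^ n.+1) <= j <oo)
        (c s * shift_ratio p w k l j)%:E <= e%:E)%E.
Proof.
move=> g0 sR c0 ct e0; have e20 : 0 < e / 2 by lra.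
have pow_ge0 s : (0 <= (1 / (2 ^ s.+1)%:R : R)%:E)%E by rewrite lee_fin.
have := le_lt_trans (epsilon_trick0 xpredT (@ler01 R)) (ltry 1).
move=> /(nneseries_tail_small pow_ge0)/(_ e20)[N hN].
pose s0 := maxn k N; pose K := \sum_(0 <= s < s0) c s.
have K0 : 0 <= K by apply: sumr_ge0.
have [|n1 hn1] := supR_small (e := e / 2 / (1 + K)) g0 sR.
  by rewrite divr_gt0//; lra.
exists (maxn 1 n1) => n l; rewrite geq_max => /andP[n_gt0 n1n] hl.
pose G s : \bar R := (\sum_(maxn (t s) (m ^ n.+1) <= j <oo)
  (c s * shift_ratio p w k l j)%:E)%E.
have r0 s j : (0 <= (c s * shift_ratio p w k l j)%:E)%E.
  by rewrite lee_fin mulr_ge0 ?shift_ratio_ge0.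
have G0 s : (0 <= G s)%E by apply: nneseries_ge0.
rewrite (@nneseries_split _ G 0 s0)// add0n.
have -> : e%:E = ((e / 2)%:E + (e / 2)%:E)%E by rewrite -EFinD -splitr.
apply: leeD.
  apply: (@le_trans _ _ (\sum_(0 <= s < s0) (c s * (e / 2 / (1 + K)))%:E)%E).
    apply: lee_sum => s _; rewrite EFinM.
    apply: (@le_trans _ _ ((c s)%:E * supR p w alpha m gamma n k)%E); last first.
      by apply: lee_wpmul2l; rewrite ?lee_fin//; exact: hn1.
    apply: (@le_trans _ _
        (\sum_(m ^ n.+1 <= j <oo) (c s * shift_ratio p w k l j)%:E)%E).
      by apply: nneseries_tail_le => //; rewrite leq_maxr.
    under eq_eseriesr do rewrite EFinM.
    rewrite nneseriesZl; last by move=> *; rewrite lee_fin shift_ratio_ge0.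
    by apply: lee_wpmul2l; [rewrite lee_fin|exact: shift_ratio_sum_le_supR].
  rewrite sumEFin lee_fin -mulr_suml -/K.
  rewrite mulrCA ler_piMr ?(ltW e20)//.
  by rewrite ler_pdivrMr ?mul1r ?lerDr// ltr_pwDl.
apply: le_trans (hN s0 (leq_maxr _ _)).
rewrite [leLHS]eseries_tailE [leRHS]eseries_tailE; apply: lee_nneseries => s *.
  by case: ifP.
case: ifP => // /(leq_trans (leq_maxl k N)) ks; exact: ct.
Qed.

(** * A countable dense set of targets *)

(** Lists of rational pairs form a countable type, so targets can be coded by [pickle]; the default
    of [nth] extends a list by zeros. *)
Definition ratc_seq (R : realType) (q : seq (rat * rat)) (i : nat) : R[i] :=
  (ratr (nth (0, 0) q i).1 +i* ratr (nth (0, 0) q i).2)%C.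

Lemma ratc_seq_default (R : realType) (q : seq (rat * rat)) (i : nat) :
  (size q <= i)%N -> ratc_seq R q i = 0.
Proof. by move=> qi; rewrite /ratc_seq nth_default//= rmorph0. Qed.

Lemma ratc_seq_dense (R : realType) (p e : R) (x : nat -> R[i]) :
  0 < p -> 0 < e -> in_lp p x ->
  exists q, (\sum_(0 <= i <oo) (cabs (ratc_seq R q i - x i) `^ p)%:E <= e%:E)%E.
Proof.
move=> p0 e0 xlp; have e20 : 0 < e / 2 by lra.
have x0 i : (0 <= (cabs (x i) `^ p)%:E)%E by rewrite lee_fin powR_ge0.
have [N hN] := nneseries_tail_small x0 (eseries_lt_of_in_lp xlp) e20.
(* Half of e pays for the tail of x, the other half is shared among the first N entries; N + 1 keeps
   the denominator nonzero when N = 0. *)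
have d0 : 0 < e / 2 / N.+1%:R by rewrite divr_gt0.
have r0 : 0 < (e / 2 / N.+1%:R) `^ p^-1 by rewrite powR_gt0.
have /choice[q hq] := fun i => rat_complex_approx (x i) r0.
exists (mkseq q N); rewrite (@nneseries_split _ _ 0 N); last first.
  by move=> *; rewrite lee_fin powR_ge0.
rewrite add0n.
have -> : e%:E = ((e / 2)%:E + (e / 2)%:E)%E by rewrite -EFinD -splitr.
apply: leeD.
  rewrite sumEFin lee_fin big_mkord.
  apply: (@le_trans _ _ (\sum_(i < N) e / 2 / N.+1%:R)).
    apply: ler_sum => i _; rewrite /ratc_seq nth_mkseq//.
    rewrite [leRHS](_ : _ = ((e / 2 / N.+1%:R) `^ p^-1) `^ p); last first.
      by rewrite -powRrM mulVf ?gt_eqF// powRr1// ltW.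
    apply: ge0_ler_powR; rewrite ?nnegrE ?cabs_ge0 ?(ltW p0) ?(ltW r0)//; exact: ltW.
  rewrite sumr_const card_ord -[leLHS]mulr_natr -mulrA ler_piMr ?(ltW e20)//.
  by rewrite mulrC ler_pdivrMr ?mul1r ?ler_nat.
apply: le_trans (hN N (leqnn _)); rewrite [leLHS]eseries_tailE [leRHS]eseries_tailE.
apply: lee_nneseries => i *; first by case: ifP => // _; rewrite lee_fin powR_ge0.
case: ifP => // Ni; rewrite ratc_seq_default ?size_mkseq// sub0r.
by rewrite /cabs normcN.
Qed.

(** * Choice of the parameters and conclusion *)

Lemma exists_common_fhc (R : realType) (p : R) (w : nat -> nat -> R[i])
    (alpha : nat -> R) (m gamma : nat) :
  0 < p -> (forall k, is_weight (w k)) -> (forall j, 0 < infW w j) ->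
  (forall k, \sum_(0 <= j <oo) (cabs (Wprod (w k) j) `^ (- p))%:E < +oo)%E ->
  (2 <= gamma)%N -> (gamma < m)%N ->
  (forall k, \sum_(1 <= n <oo) supR p w alpha m gamma n k < +oo)%E ->
  exists2 x, in_lp p x & common_fhc p w x.
Proof.
move=> p0 hw W0 sW g2 gm sR; have g0 : (0 < gamma)%N by lia.
have m1 : (1 < m)%N by lia.
(* A label that codes no triple receives the zero target. *)
pose pat s : nat * nat * seq (rat * rat) := odflt (0%N, 0%N, [::]) (unpickle s).
pose k s := (pat s).1.1; pose eps s : R := (pat s).1.2.+1%:R^-1.
pose y s := ratc_seq R (pat s).2.
pose b s i := y s i * Wprod (w (k s)) i.
(* Each label is treated separately, in the order c, d, t: c bounds the pattern for every period d,
   and both d and t are tail thresholds depending on c. *)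
pose params s (cdt : R * nat * nat) := let: (c, d, t) := cdt in
  [/\ 0 <= c, forall i, cabs (b s i) `^ p <= c,
    (0 < d)%N /\ (size (pat s).2 <= d)%N,
    (\sum_(d <= i <oo) (c * cabs (Wprod (w (k s)) i) `^ (- p))%:E
       <= (eps s)%:E)%E &
    (\sum_(t <= i <oo) (c * cabs (Wprod (w (k s)) i) `^ (- p))%:E
       <= (1 / (2 ^ s.+1)%:R)%:E)%E /\
    (* Diagonal condition: [t s] serves only the operators k' <= s, finitely many. A given operator
       then misses it for finitely many labels only, which [shift_ratio_double_sum_small]
       absorbs. *)
    forall k' n l, (k' <= s)%N -> (0 < n)%N ->
      (m ^ n <= l <= gamma * m ^ n)%N ->
      (\sum_(maxn t (m ^ n.+1) <= j <oo) (c * shift_ratio p w k' l j)%:E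
         <= (1 / (2 ^ s.+1)%:R)%:E)%E].
have /choice[f hf] : forall s, exists cdt, params s cdt.
  move=> s; pose c := \sum_(0 <= i < size (pat s).2) cabs (b s i) `^ p.
  have c0 : 0 <= c by apply: sumr_ge0 => i _; exact: powR_ge0.
  have bc i : cabs (b s i) `^ p <= c.
    have [si|is_] := leqP (size (pat s).2) i.
      by rewrite /b /y ratc_seq_default// mul0r cabs0 powR0 ?gt_eqF.
    rewrite /c (bigD1_seq i) ?mem_index_iota ?iota_uniq//= lerDl.
    by apply: sumr_ge0 => j _; exact: powR_ge0.
  have cW0 i : (0 <= (c * cabs (Wprod (w (k s)) i) `^ (- p))%:E)%E.
    by rewrite lee_fin mulr_ge0 ?powR_ge0.
  have cW : (\sum_(0 <= i <oo) (c * cabs (Wprod (w (k s)) i) `^ (- p))%:E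
      < +oo)%E.
    under eq_eseriesr do rewrite EFinM.
    rewrite nneseriesZl; last by move=> *; rewrite lee_fin powR_ge0.
    by rewrite lte_mul_pinfty ?lee_fin.
  have e0 : 0 < eps s by rewrite invr_gt0.
  have h0 : 0 < 1 / (2 ^ s.+1)%:R :> R by rewrite divr_gt0// ltr0n expn_gt0.
  have [d hd] := nneseries_tail_small cW0 cW e0.
  have [t1 ht1] := nneseries_tail_small cW0 cW h0.
  have h1 : 0 < 1 / (2 ^ s.+1)%:R / (1 + c) by rewrite divr_gt0//; lra.
  have /choice[t2 ht2] := fun k' => shift_ratio_tail_small g0 (sR k') h1.
  exists (c, maxn d (maxn 1 (size (pat s).2)), maxn t1 (\max_(i < s.+1) t2 i)).
  split => //; [by split; lia|by apply: hd; lia|split].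
    by apply: ht1; rewrite leq_maxl.
  move=> k' n l k's n_gt0 hl.
  under eq_eseriesr do rewrite EFinM.
  rewrite nneseriesZl; last by move=> *; rewrite lee_fin shift_ratio_ge0.
  apply: (@le_trans _ _ (c%:E * (1 / (2 ^ s.+1)%:R / (1 + c))%:E)%E).
    apply: lee_wpmul2l; rewrite ?lee_fin//; apply: (ht2 k') => //.
    rewrite leq_max; apply/orP; right.
    exact: (leq_bigmax (F := fun i : 'I_s.+1 => t2 i) (Ordinal (k's : (k' < s.+1)%N))).
  rewrite -EFinM lee_fin.
  have -> : c * (1 / (2 ^ s.+1)%:R / (1 + c)) = 1 / (2 ^ s.+1)%:R * (c / (1 + c)).
    by rewrite mulrCA.
  by rewrite ler_piMr ?divr_ge0// ler_pdivrMr ?mul1r ?lerDr// ltr_pwDl.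
pose c s := (f s).1.1; pose d s := (f s).1.2; pose t s := (f s).2.
have {}hf s : params s (c s, d s, t s).
  by have := hf s; rewrite /c /d /t; case: (f s) => -[].
have c0 s : 0 <= c s by have [] := hf s.
have bc s i : cabs (b s i) `^ p <= c s by have [] := hf s.
exists (block_vector w m k d t b).
  by apply: (@block_vector_summable R p w m k d t b c p0 c0 bc) => s; have [_ _ _ _ []] := hf s.
move=> k0 U [Ulp Uopen] [x0 Ux0]; have [e e0 eU] := Uopen x0 Ux0.
have C0 : 0 < 2 `^ p :> R by rewrite powR_gt0.
(* Three errors of size [dl] will occur: the tail within the block, the later blocks, and the
   rational approximation. Multiplied by 2^p they amount to 3/4 of e^p. *)
pose dl := e `^ p / (4 * 2 `^ p).
have dl0 : 0 < dl by rewrite divr_gt0 ?powR_gt0// mulr_gt0.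
have [q hq] := ratc_seq_dense p0 dl0 (Ulp _ Ux0).
(* Makes [eps s] = 1/(r + 1) at most [dl]. *)
pose r := Num.truncn dl^-1.
pose s := pickle (k0, r, q).
have patE : pat s = (k0, r, q) by rewrite /pat pickleK.
have ks : k s = k0 by rewrite /k patE.
have ys : y s = ratc_seq R q by rewrite /y patE.
have epss : eps s <= dl.
  rewrite /eps patE /= -[leRHS]invrK lef_pV2 ?posrE ?invr_gt0//.
  by apply/ltW/truncnS_gt.
have [_ _ [ds0 dsq] dse _] := hf s.
have [n1 hn1] := shift_ratio_double_sum_small g0 (sR k0) c0
  (fun s n l ks n_gt0 hl => let: And5 _ _ _ _ h := hf s in h.2 k0 n l ks n_gt0 hl)
  dl0.
apply: (pos_lower_density_blocks (s := s) (n0 := maxn n1 (maxn (d s) (t s)))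
  _ g2 gm ds0).
move=> n l; rewrite !geq_max => /and3P[n1n dn tn] ns hl dl_.
(* Thus n >= [d s] and n >= [t s] give the bounds by m^n that the orbit estimate requires. *)
have nm : (n <= m ^ n)%N by apply/ltnW/ltn_expl.
have orb := @block_vector_orbit R p w m gamma k d t b c (y s) s n l p0 hw W0 g0
  gm c0 bc (fun=> erefl) (fun i di => ratc_seq_default R (leq_trans dsq di)).
have {}orb := orb (introT andP (conj ds0 (leq_trans dn nm)))
  (leq_trans tn nm) ns hl dl_.
rewrite ks ys in orb dse.
have {}orb := le_trans orb (leeD (le_trans dse _) (hn1 n l n1n hl)).
have {}orb := orb dl%:E; rewrite lee_fin in orb; have {}orb := orb epss.
rewrite -EFinD in orb.
set z := iter l _ _ in orb *.
have zx : (\sum_(0 <= i <oo) (cabs (z i - x0 i) `^ p)%:E < (e `^ p)%:E)%E.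
  apply: (@le_lt_trans _ _ ((2 `^ p)%:E * (dl + dl + dl)%:E)%E); last first.
    rewrite -EFinM lte_fin.
    have -> : 2 `^ p * (dl + dl + dl) = e `^ p * (3 / 4) by rewrite /dl; field; lra.
    by rewrite gtr_pMr ?powR_gt0//; lra.
  rewrite EFinD; apply: le_trans (lee_wpmul2l _ (leeD orb hq)); last first.
    by rewrite lee_fin ltW.
  rewrite -nneseriesD => [|i _ _|i _ _]; rewrite ?lee_fin ?powR_ge0//.
  rewrite -nneseriesZl; last by move=> i _; rewrite -EFinD lee_fin addr_ge0 ?powR_ge0.
  apply: lee_nneseries => i *; first by rewrite lee_fin powR_ge0.
  rewrite -EFinD -EFinM lee_fin (_ : z i - x0 i =
    (z i - ratc_seq R q i) + (ratc_seq R q i - x0 i)); last by rewrite addrA subrK.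
  exact/cabsD_powR_le/ltW.
have [_ lt_e] := lp_of_eseries_lt p0 e0 zx.
(* The iterate lies in ell_p because its difference with x0 and x0 itself do. *)
apply: eU => //; apply: in_lp_of_eseries => //.
apply: (@le_lt_trans _ _ ((2 `^ p)%:E * ((e `^ p)%:E +
    \sum_(0 <= i <oo) (cabs (x0 i) `^ p)%:E))%E); last first.
  rewrite lte_mul_pinfty ?lee_fin ?ltW// lte_add_pinfty ?ltry//.
  exact/eseries_lt_of_in_lp/Ulp.
have x00 i : (0 <= (cabs (x0 i) `^ p)%:E)%E by rewrite lee_fin powR_ge0.
apply: le_trans (lee_wpmul2l _ (leeD (ltW zx) (lexx _))); last first.
  by rewrite lee_fin ltW.
rewrite -nneseriesD => [|i _ _|i _ _]; rewrite ?lee_fin ?powR_ge0//.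
rewrite -nneseriesZl; last by move=> i _; rewrite -EFinD lee_fin addr_ge0 ?powR_ge0.
apply: lee_nneseries => i *; first by rewrite lee_fin powR_ge0.
rewrite -EFinD -EFinM lee_fin -[X in cabs X `^ p](subrK (x0 i)).
exact/cabsD_powR_le/ltW.
Qed.

Theorem theorem4p2 (R : realType) (p : R) (w : nat -> nat -> R[i])
  (hp : 1 <= p)
  (hw : forall k, is_weight (w k))
  (hinf : forall n : nat, exists2 c : R, 0 < c &
            forall k, c <= cabs (Wprod (w k) n))
  (hdecay : forall k, exists C : R, exists tau : R, [/\ 0 < C, 0 < tau &
            forall n : nat, (1 <= n)%N ->
              cabs (Wprod (w k) n) `^ (- p)
              <= C * n%:R^-1 * ln (n.+1%:R) `^ (- (1 + p / 2 + tau))])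
  (hmain : exists gamma m : nat, [/\ (2 <= gamma)%N, (gamma < m)%N &
     exists alpha : nat -> R, [/\ forall l, 0 < alpha l,
       forall i j : nat, (i < j)%N -> alpha i < alpha j,
       alpha l @[l --> \oo] --> +oo,
       exists2 eps : R, 0 < eps & exists K : R, exists L : nat,
         forall l : nat, (L <= l)%N ->
           \sum_(i < l.+1) alpha i <= K * (l%:R ^+ 2 / ln l%:R `^ (1 + eps)) &
       forall k : nat,
         (\sum_(1 <= n <oo) supR p w alpha m gamma n k < +oo)%E]]) :
  exists (d : measure_display) (Omega : measurableType d)
         (P : probability Omega R) (X : Omega -> nat -> R[i]),
    [/\ forall j : nat, measurable_fun setT (fun om => @complex.Re R (X om j))
                     /\ measurable_fun setT (fun om => @complex.Im R (X om j)),
        forall om, in_lp p (X om) &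
        {ae P, forall om, common_fhc p w (X om)}].
Proof.
have p0 : 0 < p by lra.
have W0 j : 0 < infW w j by exact: infW_gt0.
have sW k : (\sum_(0 <= j <oo) (cabs (Wprod (w k) j) `^ (- p))%:E < +oo)%E.
  have [C [tau [C0 tau0 hC]]] := hdecay k.
  (* The decay exponent is read as 1 + a with a = p/2 + tau. *)
  apply: (@nneseries_log_decay R _ C (p / 2 + tau)) => // [j||n n1].
  - exact: powR_ge0.
  - lra.
  - by rewrite addrA; exact: hC.
have [gamma [m [g2 gm [alpha [_ _ _ _ sR]]]]] := hmain.
have [x xlp xfhc] := exists_common_fhc p0 hw W0 sW g2 gm sR.
exists _, unit, (\d_tt : probability _ _), (fun=> x); split => //.
exact: aeW.
Qed.
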